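(* Let $n,d,k$ be positive integers with $k<d$, let $\mathbf{X}\in\mathbb{R}^{n\times d}$, let $\mathbf{K}_c\in\mathbb{R}^{n\times n}$ be a centered kernel matrix, and let $\alpha,\beta>0$. For $\mathbf{W}\in\mathbb{R}^{d\times k}$ and $\mathbf{H}\in\mathbb{R}^{k\times d}$ define $$\mathcal{J}(\mathbf{W},\mathbf{H})=-\tfrac12\operatorname{Tr}\left(\mathbf{K}_c\mathbf{X}\mathbf{W}\mathbf{H}\mathbf{H}^T\mathbf{W}^T\mathbf{X}^T\right)+\tfrac{\alpha}{2}\left[\operatorname{Tr}\left(\mathbf{1}_{d\times d}\mathbf{W}\mathbf{W}^T\right)-\operatorname{Tr}\left(\mathbf{W}\mathbf{W}^T\right)\right]+\tfrac{\beta}{2}\left[\operatorname{Tr}\left(\mathbf{1}_{d\times d}\mathbf{H}^T\mathbf{H}\right)-\operatorname{Tr}\left(\mathbf{H}^T\mathbf{H}\right)\right].$$ Then for all $\mathbf{W},\mathbf{H}$ with nonnegative entries, the value of $\mathcal{J}$ does not increase under either of the following two updates: (1) with $\mathbf{H}$ fixed, replacing $\mathbf{W}$ by $\widetilde{\mathbf{W}}$, where for all $i,j$ $$\widetilde{\mathbf{W}}_{ij}=\mathbf{W}_{ij}\sqrt{\frac{\left(\left(\mathbf{X}^T\mathbf{K}_c\mathbf{X}\right)^{+}\mathbf{W}\mathbf{H}\mathbf{H}^T+\alpha\mathbf{W}\right)_{ij}}{\left(\left(\mathbf{X}^T\mathbf{K}_c\mathbf{X}\right)^{-}\mathbf{W}\mathbf{H}\mathbf{H}^T+\alpha\mathbf{1}_{d\times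 d}\mathbf{W}\right)_{ij}}};$$ (2) with $\mathbf{W}$ fixed, replacing $\mathbf{H}$ by $\widetilde{\mathbf{H}}$, where for all $i,j$ $$\widetilde{\mathbf{H}}_{ij}=\mathbf{H}_{ij}\sqrt{\frac{\left(\mathbf{W}^T\left(\mathbf{X}^T\mathbf{K}_c\mathbf{X}\right)^{+}\mathbf{W}\mathbf{H}+\beta\mathbf{H}\right)_{ij}}{\left(\mathbf{W}^T\left(\mathbf{X}^T\mathbf{K}_c\mathbf{X}\right)^{-}\mathbf{W}\mathbf{H}+\beta\mathbf{H}\mathbf{1}_{d\times d}\right)_{ij}}}.$$ That is, $\mathcal{J}(\widetilde{\mathbf{W}},\mathbf{H})\le\mathcal{J}(\mathbf{W},\mathbf{H})$ and $\mathcal{J}(\mathbf{W},\widetilde{\mathbf{H}})\le\mathcal{J}(\mathbf{W},\mathbf{H})$.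
   Context: $\mathbf{1}_{d\times d}$ is the $d\times d$ matrix with all entries equal to $1$; $\mathbf{I}_n$ is the identity matrix. A centered kernel matrix is a matrix of the form $\mathbf{K}_c=\mathbf{\Lambda}\mathbf{K}\mathbf{\Lambda}$, where $\mathbf{K}\in\mathbb{R}^{n\times n}$ is a symmetric positive semidefinite (kernel) matrix and $\mathbf{\Lambda}=\mathbf{I}_n-\frac1n\mathbf{1}_{n\times n}$. The entries of $\mathbf{X}$ and of $\mathbf{K}_c$ may be negative. For a real matrix $\mathbf{M}$, the entrywise positive and negative parts are the nonnegative matrices $\mathbf{M}^{+}$ and $\mathbf{M}^{-}$ with entries $(\mathbf{M}^{+})_{ij}=\frac{|\mathbf{M}_{ij}|+\mathbf{M}_{ij}}{2}$ and $(\mathbf{M}^{-})_{ij}=\frac{|\mathbf{M}_{ij}|-\mathbf{M}_{ij}}{2}$, so $\mathbf{M}=\mathbf{M}^{+}-\mathbf{M}^{-}$. Convention: if a denominator in one of the update formulas is zero (which, since $\alpha,\beta>0$, forces the corresponding entry $\mathbf{W}_{ij}$, respectively $\mathbf{H}_{ij}$, to be zero), the updated entry is taken to be $0$. *)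

(* Defs.v *)
From mathcomp Require Import all_boot all_order all_algebra reals.

Set Implicit Arguments.
Unset Strict Implicit.
Unset Printing Implicit Defensive.

Import Order.TTheory GRing.Theory Num.Theory.
Local Open Scope ring_scope.

Definition ones_mx {R : realType} (m : nat) : 'M[R]_m := const_mx 1.

Definition centering_mx (R : realType) (n : nat) : 'M[R]_n :=
  1%:M - n%:R^-1 *: ones_mx n.

Definition kernel_mx {R : realType} {n : nat} (K : 'M[R]_n) : Prop :=
  K^T = K /\ forall v : 'cV[R]_n, 0 <= (v^T *m K *m v) 0 0.

Definition centered_kernel_mx {R : realType} {n : nat} (Kc : 'M[R]_n) : Prop :=
  exists2 K : 'M[R]_n, kernel_mx K &
    Kc = centering_mx R n *m K *m centering_mx R n.

Definition nonneg_mx {R : realType} {m n : nat} (M : 'M[R]_(m, n)) : Prop :=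
  forall i j, 0 <= M i j.

Definition pos_part {R : realType} {m n : nat} (M : 'M[R]_(m, n)) :
  'M[R]_(m, n) := \matrix_(i, j) ((`|M i j| + M i j) / 2).

Definition neg_part {R : realType} {m n : nat} (M : 'M[R]_(m, n)) :
  'M[R]_(m, n) := \matrix_(i, j) ((`|M i j| - M i j) / 2).

(* An entry whose denominator D i j vanishes is set to 0. *)
Definition mult_update {R : realType} {m n : nat} (M N D : 'M[R]_(m, n)) :
  'M[R]_(m, n) :=
  \matrix_(i, j)
    (if D i j == 0 then 0 else M i j * Num.sqrt (N i j / D i j)).

Definition objective {R : realType} {n d k : nat} (X : 'M[R]_(n, d))
    (Kc : 'M[R]_n) (alpha beta : R) (W : 'M[R]_(d, k)) (H : 'M[R]_(k, d)) : R :=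
  - (1 / 2) * \tr (Kc *m X *m W *m H *m H^T *m W^T *m X^T)
  + alpha / 2 * (\tr (ones_mx d *m W *m W^T) - \tr (W *m W^T))
  + beta / 2 * (\tr (ones_mx d *m H^T *m H) - \tr (H^T *m H)).

Definition update_W {R : realType} {n d k : nat} (X : 'M[R]_(n, d))
    (Kc : 'M[R]_n) (alpha : R) (W : 'M[R]_(d, k)) (H : 'M[R]_(k, d)) :
  'M[R]_(d, k) :=
  let A := X^T *m Kc *m X in
  mult_update W
    (pos_part A *m W *m H *m H^T + alpha *: W)
    (neg_part A *m W *m H *m H^T + alpha *: (ones_mx d *m W)).

Definition update_H {R : realType} {n d k : nat} (X : 'M[R]_(n, d))
    (Kc : 'M[R]_n) (beta : R) (W : 'M[R]_(d, k)) (H : 'M[R]_(k, d)) :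
  'M[R]_(k, d) :=
  let A := X^T *m Kc *m X in
  mult_update H
    (W^T *m pos_part A *m W *m H + beta *: H)
    (W^T *m neg_part A *m W *m H + beta *: (H *m ones_mx d)).

(* Main.v *)
(** With the other factor fixed, twice the objective is, up to a constant, a
difference [P - N] of quadratic forms with symmetric nonnegative kernels, and
the update is [u = t w] entrywise with [t^2 = (N w) / (P w)].  Bounding
[t t' <= (t^2 + t'^2) / 2] in [P u] gives [P u <= N w], and bounding
[2 - t t' <= 1 / (t t') <= (t^-2 + t'^-2) / 2] in [2 N w - N u] gives
[2 N w - N u <= P w]; the sum of the two is the claim. *)

Require Import Defs.
From mathcomp Require Import all_boot all_order all_algebra reals ring lra.

Set Implicit Arguments.
Unset Strict Implicit.
Unset Printing Implicit Defensive.

Import Order.TTheory GRing.Theory Num.Theory.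
Local Open Scope ring_scope.

(** * Quadratic forms on a finite index set and their multiplicative updates *)

Definition qform {R : realFieldType} {I : finType} (K : I -> I -> R)
    (w : I -> R) : R :=
  \sum_x \sum_y K x y * (w x * w y).

Lemma qformE (R : realFieldType) (I : finType) (K : I -> I -> R) (w : I -> R) :
  qform K w = \sum_x w x * \sum_y K x y * w y.
Proof.
apply: eq_bigr => x _; rewrite mulr_sumr; apply: eq_bigr => y _; ring.
Qed.

(** Exchanging [x] and [y] preserves the weight [K x y * (w x * w y)], so the two halves of the mean
    contribute equally. With [f] the square of the update factor or its inverse, this turns a
    termwise bound back into weighted row sums. *)
Lemma symmetric_kernel_mean (R : realFieldType) (I : finType)
    (K : I -> I -> R) (w f : I -> R) :
  (forall x y, K x y = K y x) ->
  \sum_x \sum_y K x y * (w x * w y) * ((f x + f y) / 2)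
    = \sum_x w x * f x * \sum_y K x y * w y.
Proof.
move=> Ksym.
pose S := \sum_x \sum_y K x y * (w x * w y) * (f x / 2).
have SE : \sum_x \sum_y K x y * (w x * w y) * (f y / 2) = S.
  rewrite exchange_big; apply: eq_bigr => x _; apply: eq_bigr => y _.
  by rewrite (Ksym y x) (mulrC (w y)).
transitivity (S + S).
  rewrite -{2}SE /S -big_split; apply: eq_bigr => x _; rewrite -big_split.
  by apply: eq_bigr => y _ /=; rewrite -mulrDr -mulrDl.
rewrite /S -big_split; apply: eq_bigr => x _; rewrite -big_split mulr_sumr.
by apply: eq_bigr => y _ /=; field.
Qed.

(** With [p = r * s], this chains [2 - p <= 1 / p] and the arithmetic-geometric mean inequality for
    the inverses; each of the two gaps is a square up to a positive factor. *)
Lemma two_sub_mul_le (R : realFieldType) (r s : R) : 0 < r -> 0 < s ->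
  2 - r * s <= ((r ^+ 2)^-1 + (s ^+ 2)^-1) / 2.
Proof.
move=> r0 s0; rewrite -subr_ge0.
have -> : ((r ^+ 2)^-1 + (s ^+ 2)^-1) / 2 - (2 - r * s)
    = (r^-1 - s^-1) ^+ 2 / 2 + (r * s - 1) ^+ 2 / (r * s).
  by field; rewrite !gt_eqF.
by rewrite addr_ge0 ?divr_ge0 ?sqr_ge0 ?mulr_ge0 // ltW.
Qed.

(** The positive diagonals make both row sums at [x] positive as soon as [w x] is, so the update
    factor is positive there; indices with [w x = 0] contribute nothing to any of the forms. *)
Lemma qform_mult_update (R : rcfType) (I : finType) (N P : I -> I -> R)
    (w u : I -> R) :
  (forall x y, N x y = N y x) -> (forall x y, P x y = P y x) ->
  (forall x y, 0 <= N x y) -> (forall x y, 0 <= P x y) ->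
  (forall x, 0 < N x x) -> (forall x, 0 < P x x) ->
  (forall x, 0 <= w x) ->
  (forall x, u x = if \sum_y P x y * w y == 0 then 0 else
     w x * Num.sqrt ((\sum_y N x y * w y) / (\sum_y P x y * w y))) ->
  qform P u - qform N u <= qform P w - qform N w.
Proof.
move=> Nsym Psym N0 P0 Nd Pd w0 uE.
pose a x := \sum_y N x y * w y; pose b x := \sum_y P x y * w y.
pose t x := Num.sqrt (a x / b x).
have row_gt0 K x : (forall x y, 0 <= K x y) -> 0 < K x x -> 0 < w x ->
    0 < \sum_y K x y * w y.
  move=> K0 Kd wx; rewrite (bigD1 x) //= ltr_wpDr ?mulr_gt0 //.
  by apply: sumr_ge0 => y _; rewrite mulr_ge0.
have a_gt0 x : 0 < w x -> 0 < a x by exact: row_gt0.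
have b_gt0 x : 0 < w x -> 0 < b x by exact: row_gt0.
have t_gt0 x : 0 < w x -> 0 < t x.
  by move=> wx; rewrite sqrtr_gt0 divr_gt0 ?a_gt0 ?b_gt0.
have t2 x : 0 < w x -> t x ^+ 2 = a x / b x.
  by move=> wx; rewrite sqr_sqrtr // divr_ge0 // ltW ?a_gt0 ?b_gt0.
have wP x : w x = 0 \/ 0 < w x.
  by have := w0 x; rewrite le_eqVlt => /orP[/eqP <-|]; [left|right].
(* The default value 0 agrees with the product: a vanishing denominator is possible only where
   [w x = 0]. *)
have ut x : u x = w x * t x.
  rewrite uE; case: (wP x) => [->|wx]; first by rewrite !mul0r; case: ifP.
  by rewrite (gt_eqF (b_gt0 x wx)).
have leP : qform P u <= qform N w.
  rewrite [leRHS]qformE.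
  (* Since [a x = t x ^+ 2 * b x] wherever [w x] is positive, the form of [N] becomes a weighted sum
     of rows of [P], which can be compared with [qform P u] term by term. *)
  have -> : \sum_x w x * (\sum_y N x y * w y)
      = \sum_x w x * t x ^+ 2 * \sum_y P x y * w y.
    apply: eq_bigr => x _; case: (wP x) => [->|wx]; first by rewrite !mul0r.
    by rewrite t2 // -/(a x) -/(b x) -mulrA divfK // gt_eqF // b_gt0.
  rewrite -symmetric_kernel_mean //; apply: ler_sum => x _.
  apply: ler_sum => y _; rewrite !ut.
  have -> : P x y * (w x * t x * (w y * t y))
      = P x y * (w x * w y) * (t x * t y) by ring.
  apply: ler_wpM2l; first by rewrite !mulr_ge0.
  by have := sqr_ge0 (t x - t y); lra.
have leN : 2 * qform N w - qform N u <= qform P w.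
  rewrite [leRHS]qformE.
  (* The same exchange in the other direction: [b x] is [a x] divided by [t x ^+ 2]. *)
  have -> : \sum_x w x * (\sum_y P x y * w y)
      = \sum_x w x * (t x ^+ 2)^-1 * \sum_y N x y * w y.
    apply: eq_bigr => x _; case: (wP x) => [->|wx]; first by rewrite !mul0r.
    by rewrite t2 // -/(a x) -/(b x) invf_div -mulrA divfK // gt_eqF // a_gt0.
  rewrite -symmetric_kernel_mean // mulr_sumr -sumrB; apply: ler_sum => x _.
  rewrite mulr_sumr -sumrB; apply: ler_sum => y _; rewrite !ut.
  have -> : 2 * (N x y * (w x * w y)) - N x y * (w x * t x * (w y * t y))
      = N x y * (w x * w y) * (2 - t x * t y) by ring.
  (* The bound on [2 - t x * t y] requires both factors to be positive, which is known only where
     [w] is positive; otherwise both sides are 0. *)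
  case: (wP x) => [->|wx]; first by rewrite !(mul0r, mulr0).
  case: (wP y) => [->|wy]; first by rewrite !(mul0r, mulr0).
  by apply: ler_wpM2l; rewrite ?mulr_ge0 // two_sub_mul_le ?t_gt0.
lra.
Qed.

(** * From matrix traces to quadratic forms indexed by matrix entries *)

(** The matrix of the linear map sending [Z] to [S *m Z *m T] in the basis of entries, that is, the
    Kronecker product of [S] and [T^T]; hence the reversed indices of [T]. *)
Definition sandwich_kernel {R : realFieldType} {m p : nat} (S : 'M[R]_m)
    (T : 'M[R]_p) (x y : 'I_m * 'I_p) : R :=
  S x.1 y.1 * T y.2 x.2.

Lemma sandwich_kernel_sum (R : realFieldType) (m p : nat) (S : 'M[R]_m)
    (T : 'M[R]_p) (M : 'M[R]_(m, p)) (x : 'I_m * 'I_p) :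
  (S *m M *m T) x.1 x.2 = \sum_y sandwich_kernel S T x y * M y.1 y.2.
Proof.
rewrite mxE; under eq_bigr => j _ do rewrite mxE mulr_suml.
rewrite exchange_big pair_big /=; apply: eq_bigr => y _.
by rewrite /sandwich_kernel mulrAC.
Qed.

Lemma mxtrace_mul_trmx (R : realFieldType) (m p : nat) (A M : 'M[R]_(m, p)) :
  \tr (A *m M^T) = \sum_x A x.1 x.2 * M x.1 x.2.
Proof.
rewrite /mxtrace; under eq_bigr => i _ do rewrite mxE.
by rewrite pair_big /=; apply: eq_bigr => x _; rewrite mxE.
Qed.

(** A common form for both updates: the numerator and the denominator are each a sum of two
    sandwiches. The first needs only nonnegative entries; the second has positive diagonals, which
    makes the diagonal of the whole kernel positive. *)
Lemma mxtrace_mult_update (R : realType) (m p : nat) (S1 S2 S3 S4 : 'M[R]_m)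
    (T1 T2 T3 T4 : 'M[R]_p) (M : 'M[R]_(m, p)) :
  S1^T = S1 -> S2^T = S2 -> S3^T = S3 -> S4^T = S4 ->
  T1^T = T1 -> T2^T = T2 -> T3^T = T3 -> T4^T = T4 ->
  nonneg_mx S1 -> nonneg_mx S2 -> nonneg_mx S3 -> nonneg_mx S4 ->
  nonneg_mx T1 -> nonneg_mx T2 -> nonneg_mx T3 -> nonneg_mx T4 ->
  (forall i, 0 < S2 i i) -> (forall i, 0 < S4 i i) ->
  (forall j, 0 < T2 j j) -> (forall j, 0 < T4 j j) ->
  nonneg_mx M ->
  let N (Z : 'M[R]_(m, p)) := S1 *m Z *m T1 + S2 *m Z *m T2 in
  let P (Z : 'M[R]_(m, p)) := S3 *m Z *m T3 + S4 *m Z *m T4 in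
  let U := mult_update M (N M) (P M) in
  (\tr (P U *m U^T) - \tr (N U *m U^T)
     <= \tr (P M *m M^T) - \tr (N M *m M^T) : Prop).
Proof.
move=> S1t S2t S3t S4t T1t T2t T3t T4t S10 S20 S30 S40 T10 T20 T30 T40.
move=> S2d S4d T2d T4d M0 N P U.
pose ker (S S' : 'M[R]_m) (T T' : 'M[R]_p) x y :=
  sandwich_kernel S T x y + sandwich_kernel S' T' x y.
have ker_sum S S' T T' Z x : (S *m Z *m T + S' *m Z *m T') x.1 x.2
    = \sum_y ker S S' T T' x y * Z y.1 y.2.
  rewrite mxE !sandwich_kernel_sum -big_split; apply: eq_bigr => y _.
  by rewrite /= -mulrDl.
have trE S S' T T' Z : \tr ((S *m Z *m T + S' *m Z *m T') *m Z^T)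
    = qform (ker S S' T T') (fun x => Z x.1 x.2).
  rewrite mxtrace_mul_trmx qformE; apply: eq_bigr => x _.
  by rewrite ker_sum mulrC.
have ker_sym S S' T T' x y : S^T = S -> S'^T = S' -> T^T = T -> T'^T = T' ->
    ker S S' T T' x y = ker S S' T T' y x.
  move=> St S't Tt T't; rewrite /ker /sandwich_kernel.
  by rewrite -{1}St -{1}S't -{1}Tt -{1}T't !mxE.
have ker_ge0 S S' T T' x y : nonneg_mx S -> nonneg_mx S' -> nonneg_mx T ->
    nonneg_mx T' -> 0 <= ker S S' T T' x y.
  by move=> S0 S'0 T0 T'0; rewrite addr_ge0 ?mulr_ge0.
have ker_gt0 S (S' : 'M_m) T (T' : 'M_p) x : nonneg_mx S -> nonneg_mx T ->
    (forall i, 0 < S' i i) -> (forall j, 0 < T' j j) ->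
    0 < ker S S' T T' x x.
  by move=> S0 T0 S'0 T'0; rewrite ltr_wpDl ?mulr_ge0 ?mulr_gt0.
rewrite !trE; apply: qform_mult_update => [x y|x y|x y|x y|x|x|x|x].
- exact: ker_sym.
- exact: ker_sym.
- exact: ker_ge0.
- exact: ker_ge0.
- exact: ker_gt0.
- exact: ker_gt0.
- exact: M0.
- by rewrite mxE -!ker_sum.
Qed.

(** * Signs and symmetry of the matrices that occur in the updates *)

Lemma pos_neg_part (R : realType) (m n : nat) (M : 'M[R]_(m, n)) :
  M = pos_part M - neg_part M.
Proof. by apply/matrixP => i j; rewrite !mxE; field. Qed.

Lemma pos_part_ge0 (R : realType) (m n : nat) (M : 'M[R]_(m, n)) :
  nonneg_mx (pos_part M).
Proof.
move=> i j; rewrite mxE divr_ge0 // -lerBlDr sub0r.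
by rewrite -normrN ler_norm.
Qed.

Lemma neg_part_ge0 (R : realType) (m n : nat) (M : 'M[R]_(m, n)) :
  nonneg_mx (neg_part M).
Proof. by move=> i j; rewrite mxE divr_ge0 // subr_ge0 ler_norm. Qed.

Lemma trmx_pos_part (R : realType) (m n : nat) (M : 'M[R]_(m, n)) :
  (pos_part M)^T = pos_part M^T.
Proof. by apply/matrixP => i j; rewrite !mxE. Qed.

Lemma trmx_neg_part (R : realType) (m n : nat) (M : 'M[R]_(m, n)) :
  (neg_part M)^T = neg_part M^T.
Proof. by apply/matrixP => i j; rewrite !mxE. Qed.

Lemma nonneg_mulmx (R : realType) (m n p : nat) (A : 'M[R]_(m, n))
    (B : 'M[R]_(n, p)) :
  nonneg_mx A -> nonneg_mx B -> nonneg_mx (A *m B).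
Proof.
by move=> A0 B0 i j; rewrite mxE sumr_ge0 // => l _; rewrite mulr_ge0.
Qed.

Lemma nonneg_trmx (R : realType) (m n : nat) (A : 'M[R]_(m, n)) :
  nonneg_mx A -> nonneg_mx A^T.
Proof. by move=> A0 i j; rewrite mxE. Qed.

Lemma nonneg_scalar_mx (R : realType) (m : nat) (a : R) :
  0 <= a -> nonneg_mx (a%:M : 'M[R]_m).
Proof. by move=> a0 i j; rewrite mxE mulrn_wge0. Qed.

Lemma nonneg_scale_ones (R : realType) (m : nat) (a : R) :
  0 <= a -> nonneg_mx (a *: ones_mx m).
Proof. by move=> a0 i j; rewrite !mxE mulr1. Qed.

Lemma trmx_scale_ones (R : realType) (m : nat) (a : R) :
  (a *: ones_mx m)^T = a *: ones_mx m.
Proof. by apply/matrixP => i j; rewrite !mxE. Qed.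

Lemma trmx_centered_kernel (R : realType) (n : nat) (Kc : 'M[R]_n) :
  centered_kernel_mx Kc -> Kc^T = Kc.
Proof.
case=> K [Kt _] ->.
have Ct : (centering_mx R n)^T = centering_mx R n.
  by rewrite /centering_mx linearB /= trmx1 trmx_scale_ones.
by rewrite !trmx_mul Ct Kt mulmxA.
Qed.

(** * The objective as a difference of two traces in one factor *)

(** Cyclicity of the trace brings [X^T] to the front and produces [A]. As the data term has a minus
    sign, [neg_part A] joins the all-ones penalty in the denominator trace. The factors [1%:M] only
    pad the terms to the sandwich shape. *)
Lemma objective_trace_W (R : realType) (n d k : nat) (X : 'M[R]_(n, d))
    (Kc : 'M[R]_n) (alpha beta : R) (W : 'M[R]_(d, k)) (H : 'M[R]_(k, d)) :
  let A := X^T *m Kc *m X in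
  objective X Kc alpha beta W H =
    (\tr ((neg_part A *m W *m (H *m H^T)
             + (alpha *: ones_mx d) *m W *m 1%:M) *m W^T)
     - \tr ((pos_part A *m W *m (H *m H^T) + alpha%:M *m W *m 1%:M) *m W^T)) / 2
    + beta / 2 * (\tr (ones_mx d *m H^T *m H) - \tr (H^T *m H)).
Proof.
move=> A; rewrite /objective.
have -> : \tr (Kc *m X *m W *m H *m H^T *m W^T *m X^T)
    = \tr (pos_part A *m W *m (H *m H^T) *m W^T)
      - \tr (neg_part A *m W *m (H *m H^T) *m W^T).
  rewrite -linearB /= -!mulmxBl -pos_neg_part mxtrace_mulC.
  by rewrite /A !mulmxA.
rewrite !mulmx1 !mulmxDl !mxtraceD mul_scalar_mx -!scalemxAl !mxtraceZ.
by field.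
Qed.

(** Here [W^T] is rotated to the front as well, so the left factor is [W^T *m A *m W] split by sign,
    and the all-ones matrix ends up to the right of [H]. *)
Lemma objective_trace_H (R : realType) (n d k : nat) (X : 'M[R]_(n, d))
    (Kc : 'M[R]_n) (alpha beta : R) (W : 'M[R]_(d, k)) (H : 'M[R]_(k, d)) :
  let A := X^T *m Kc *m X in
  objective X Kc alpha beta W H =
    (\tr (((W^T *m neg_part A *m W) *m H *m 1%:M
             + 1%:M *m H *m (beta *: ones_mx d)) *m H^T)
     - \tr (((W^T *m pos_part A *m W) *m H *m 1%:M
             + beta%:M *m H *m 1%:M) *m H^T)) / 2
    + alpha / 2 * (\tr (ones_mx d *m W *m W^T) - \tr (W *m W^T)).
Proof.
move=> A; rewrite /objective.
have -> : \tr (Kc *m X *m W *m H *m H^T *m W^T *m X^T)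
    = \tr (W^T *m pos_part A *m W *m H *m H^T)
      - \tr (W^T *m neg_part A *m W *m H *m H^T).
  rewrite -linearB /= -!mulmxBl -mulmxBr -pos_neg_part.
  by rewrite mxtrace_mulC !mulmxA mxtrace_mulC /A !mulmxA.
have -> : \tr (ones_mx d *m H^T *m H) = \tr (H *m ones_mx d *m H^T).
  by rewrite mxtrace_mulC mulmxA.
rewrite (mxtrace_mulC H^T) !mulmx1 mul1mx !mulmxDl !mxtraceD mul_scalar_mx.
rewrite -!scalemxAr -!scalemxAl !mxtraceZ.
by field.
Qed.

Theorem theorem1 (R : realType) (n d k : nat)
    (n_gt0 : (0 < n)%N) (d_gt0 : (0 < d)%N) (k_gt0 : (0 < k)%N)
    (lt_kd : (k < d)%N)
    (X : 'M[R]_(n, d)) (Kc : 'M[R]_n) (hKc : centered_kernel_mx Kc)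
    (alpha beta : R) (alpha_gt0 : 0 < alpha) (beta_gt0 : 0 < beta)
    (W : 'M[R]_(d, k)) (H : 'M[R]_(k, d))
    (W_ge0 : nonneg_mx W) (H_ge0 : nonneg_mx H) :
  objective X Kc alpha beta (update_W X Kc alpha W H) H
    <= objective X Kc alpha beta W H
  /\ objective X Kc alpha beta W (update_H X Kc beta W H)
    <= objective X Kc alpha beta W H.
Proof.
pose A := X^T *m Kc *m X.
have At : A^T = A.
  by rewrite /A !trmx_mul trmxK (trmx_centered_kernel hKc) mulmxA.
have At_pos : (pos_part A)^T = pos_part A by rewrite trmx_pos_part At.
have At_neg : (neg_part A)^T = neg_part A by rewrite trmx_neg_part At.
have A_pos := pos_part_ge0 A; have A_neg := neg_part_ge0 A.
have one_ge0 m : nonneg_mx (1%:M : 'M[R]_m) by exact: nonneg_scalar_mx.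
have diag_gt0 m (a : R) (i : 'I_m) : 0 < a -> 0 < (a%:M : 'M[R]_m) i i.
  by rewrite mxE eqxx.
have ones_gt0 m (a : R) (i : 'I_m) : 0 < a -> 0 < (a *: ones_mx m) i i.
  by rewrite !mxE mulr1.
split.
(* The penalty on [H] is common to both sides and cancels, as does the factor 1/2. *)
- rewrite !objective_trace_W lerD2r ler_pM2r ?invr_gt0 ?ltr0n //.
  (* The second sandwiches carry [alpha%:M] and [alpha *: ones_mx d], whose diagonals are positive
     because [alpha] is. *)
  have -> : update_W X Kc alpha W H = mult_update W
      (pos_part A *m W *m (H *m H^T) + alpha%:M *m W *m 1%:M)
      (neg_part A *m W *m (H *m H^T) + (alpha *: ones_mx d) *m W *m 1%:M).
    by rewrite /update_W !mulmx1 mul_scalar_mx -!scalemxAl !mulmxA.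
  apply: mxtrace_mult_update; rewrite ?tr_scalar_mx ?trmx_scale_ones //.
  + by rewrite trmx_mul trmxK.
  + by rewrite trmx_mul trmxK.
  + exact/nonneg_scalar_mx/ltW.
  + exact/nonneg_scale_ones/ltW.
  + exact/nonneg_mulmx/nonneg_trmx.
  + exact/nonneg_mulmx/nonneg_trmx.
  + by move=> i; exact: diag_gt0.
  + by move=> i; exact: ones_gt0.
  + by move=> i; exact: diag_gt0.
  + by move=> i; exact: diag_gt0.
- rewrite !objective_trace_H lerD2r ler_pM2r ?invr_gt0 ?ltr0n //.
  (* For [H] the positive diagonals come from [beta%:M] on the left in the numerator and from
     [beta *: ones_mx d] on the right in the denominator, each paired with an identity matrix. *)
  have -> : update_H X Kc beta W H = mult_update H
      ((W^T *m pos_part A *m W) *m H *m 1%:M + beta%:M *m H *m 1%:M)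
      ((W^T *m neg_part A *m W) *m H *m 1%:M
         + 1%:M *m H *m (beta *: ones_mx d)).
    by rewrite /update_H !mulmx1 mul1mx mul_scalar_mx -!scalemxAr.
  apply: mxtrace_mult_update; rewrite ?tr_scalar_mx ?trmx_scale_ones //.
  + by rewrite !trmx_mul trmxK At_pos mulmxA.
  + by rewrite !trmx_mul trmxK At_neg mulmxA.
  + by apply: nonneg_mulmx => //; apply: nonneg_mulmx => //; exact: nonneg_trmx.
  + exact/nonneg_scalar_mx/ltW.
  + by apply: nonneg_mulmx => //; apply: nonneg_mulmx => //; exact: nonneg_trmx.
  + exact/nonneg_scale_ones/ltW.
  + by move=> i; exact: diag_gt0.
  + by move=> i; exact: diag_gt0.
  + by move=> i; exact: diag_gt0.
  + by move=> i; exact: ones_gt0.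
Qed.
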